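(* For every positive integer $n$ there exist matroids $M'$ and $N'$, neither of which has a coloop, such that: each of $M'$ and $N'$ is self-dual; both are positroids; both are transversal matroids; $M'$ and $N'$ have the same configuration; and $\tau(N')-\tau(M')\geq n$.
   Context: For a matroid $M$ with rank function $r$ and $X\subseteq E(M)$, write $\overline{X}=E(M)-X$ and define the connectivity function $\lambda_M(X)=r(X)+r(\overline{X})-r(M)$. For $k\in\mathbb{N}$, a $k$-separation of $M$ is a pair $(X,\overline{X})$ with $|X|\geq k$, $|\overline{X}|\geq k$ and $\lambda_M(X)<k$. The (Tutte) connectivity $\tau(M)$ is the least $k$ such that $M$ has a $k$-separation, and $\tau(M)=\infty$ if $M$ has no $k$-separation for any $k\in\mathbb{N}$. A cyclic flat of $M$ is a flat $F$ such that $M|F$ has no coloops; the cyclic flats of $M$ form a lattice $\mathcal{Z}(M)$ under inclusion. The configuration of $M$ is the abstract lattice $\mathcal{Z}(M)$ together with the assignment, to each lattice element, of the size and rank of the corresponding cyclic flat; two matroids have the same configuration if there is a lattice isomorphism between their lattices of cyclic flats preserving the size and rank of each cyclic flat. A matroid is self-dual if it is isomorphic to its dual. A positroid is a matroid $M$ of rank $r$ with $|E(M)|=m$ that is represented over $\mathbb{R}$ by an $r\times m$ matrix all of whose $r\times r$ maximal minors are nonnegative. A matroid is transversal if it is a matroid union of rank-$1$ matroids (equivalently, its independent sets are the partial transversals of a set system). *)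

(* Defs.v *)
From HB Require Import structures.
From mathcomp Require Import all_boot all_order all_algebra.
From mathcomp Require Import boolp constructive_ereal reals.

Set Implicit Arguments.
Unset Strict Implicit.
Unset Printing Implicit Defensive.

Import Order.TTheory GRing.Theory Num.Theory.

(* The ground set is a subset of the carrier type, so that a restriction M|F
   lives on the same type as M. *)
Record matroid (T : finType) := Matroid {
  ground : {set T};
  indep : {set {set T}};
  indep_ground : forall I, I \in indep -> I \subset ground;
  indep0 : set0 \in indep;
  indep_sub : forall I J : {set T},
    J \in indep -> I \subset J -> I \in indep;
  indep_aug : forall I J : {set T},
    I \in indep -> J \in indep -> #|I| < #|J| ->
    exists2 x, x \in J :\: I & x |: I \in indep
}.

Definition rk (T : finType) (M : matroid T) (X : {set T}) : nat :=
  \max_(I in indep M | I \subset X) #|I|.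

Definition mrank (T : finType) (M : matroid T) : nat := rk M (ground M).

Definition basis (T : finType) (M : matroid T) (B : {set T}) : bool :=
  maxset (fun I => I \in indep M) B.

Definition coloop (T : finType) (M : matroid T) (e : T) : bool :=
  (e \in ground M) && [forall (B | basis M B), e \in B].

Section Restriction.
Variables (T : finType) (M : matroid T) (F : {set T}).

Definition restrict_ground : {set T} := ground M :&: F.
Definition restrict_indep : {set {set T}} :=
  [set I in indep M | I \subset F].

Fact restrict_indep_ground I :
  I \in restrict_indep -> I \subset restrict_ground.
Proof.
by rewrite inE subsetI => /andP[IM ->]; rewrite (indep_ground IM).
Qed.

Fact restrict_indep0 : set0 \in restrict_indep.
Proof. by rewrite inE indep0 sub0set. Qed.

Fact restrict_indep_sub (I J : {set T}) :
  J \in restrict_indep -> I \subset J -> I \in restrict_indep.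
Proof.
rewrite !inE => /andP[JM JF] IJ.
by rewrite (indep_sub JM IJ) (subset_trans IJ JF).
Qed.

Fact restrict_indep_aug (I J : {set T}) :
  I \in restrict_indep -> J \in restrict_indep -> #|I| < #|J| ->
  exists2 x, x \in J :\: I & x |: I \in restrict_indep.
Proof.
rewrite !inE => /andP[IM IF] /andP[JM JF] ltIJ.
have [x xJI xIM] := indep_aug IM JM ltIJ; exists x => //.
rewrite inE xIM subUset sub1set IF andbT /=.
by apply: (subsetP JF); case/setDP: xJI.
Qed.

Definition restriction : matroid T :=
  Matroid restrict_indep_ground restrict_indep0
          restrict_indep_sub restrict_indep_aug.

End Restriction.

Section Dual.
Variables (T : finType) (M : matroid T).

(* The bases of the dual are the complements of the bases of M, so its
   independent sets are the sets avoiding some basis of M. *)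
Definition dual_indep : {set {set T}} :=
  [set I : {set T} | [exists (B | basis M B), I \subset ground M :\: B]].

Fact dual_indep_ground I : I \in dual_indep -> I \subset ground M.
Proof.
by rewrite inE => /exists_inP[B _] /subset_trans; apply; apply: subsetDl.
Qed.

Fact basis_indep B : basis M B -> B \in indep M.
Proof. by case/maxsetP. Qed.

Fact dual_indep0 : set0 \in dual_indep.
Proof.
have [B mB _] := @maxset_exists _ (fun I => I \in indep M) _ (indep0 M).
by rewrite inE; apply/exists_inP; exists B => //; apply: sub0set.
Qed.

Fact dual_indep_sub (I J : {set T}) :
  J \in dual_indep -> I \subset J -> I \in dual_indep.
Proof.
rewrite !inE => /exists_inP[B mB JB] IJ.
by apply/exists_inP; exists B => //; apply: subset_trans JB.
Qed.

Fact indep_card_basis I B : I \in indep M -> basis M B -> #|I| <= #|B|.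
Proof.
move=> IM /maxsetP[BM Bmax]; rewrite leqNgt; apply/negP => ltBI.
have [x /setDP[_ xB] xBM] := indep_aug BM IM ltBI.
by rewrite -(Bmax _ xBM (subsetUr _ _)) setU11 in xB.
Qed.

Fact indep_extend (I B : {set T}) : I \in indep M -> basis M B ->
  exists2 C, basis M C & (I \subset C) && (C \subset I :|: B).
Proof.
move=> IM mB.
pose P (C : {set T}) := (C \in indep M) && (C \subset I :|: B).
have PI : P I by rewrite /P IM subsetUl.
have [C /maxsetP[/andP[CM CIB] Cmax] IC] := maxset_exists PI.
exists C; last by rewrite IC.
have leBC : #|B| <= #|C|.
  rewrite leqNgt; apply/negP => ltCB.
  have [x /setDP[xB xC] xCM] := indep_aug CM (basis_indep mB) ltCB.
  have PxC : P (x |: C).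
    by rewrite /P xCM subUset CIB andbT sub1set inE xB orbT.
  by rewrite -(Cmax _ PxC (subsetUr _ _)) setU11 in xC.
apply/maxsetP; split=> // D DM CD; apply/eqP; rewrite eq_sym eqEcard CD /=.
exact: leq_trans (indep_card_basis DM mB) leBC.
Qed.

Fact dual_indep_aug (I J : {set T}) :
  I \in dual_indep -> J \in dual_indep -> #|I| < #|J| ->
  exists2 x, x \in J :\: I & x |: I \in dual_indep.
Proof.
rewrite !inE => /exists_inP[BI mBI /subsetDP[IE dI]].
move=> /exists_inP[BJ mBJ /subsetDP[JE dJ]] ltIJ.
have BJIM : BJ :\: I \in indep M.
  by apply: indep_sub (basis_indep mBJ) (subsetDl _ _).
have [B mB /andP[BJIB BB]] := indep_extend BJIM mBI.
have dIB : [disjoint I & B].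
  rewrite disjoints_subset; apply/subsetP => x xI; rewrite inE.
  apply/negP => /(subsetP BB); rewrite !inE xI /=.
  by rewrite (disjointFr dI xI).
have [/subsetP JIB|] := boolP (J :\: I \subset B); last first.
  case/subsetPn => x xJI xB; exists x => //.
  rewrite inE; apply/exists_inP; exists B => //.
  have xJ : x \in J by case/setDP: xJI.
  apply/subsetP => y; rewrite !inE => /orP[/eqP->|yI].
    by rewrite xB (subsetP JE).
  by rewrite (disjointFr dIB yI) (subsetP IE).
have dd : [disjoint BJ :\: I & J :\: I].
  apply: disjointWl (subsetDl _ _) _; apply: disjointWr (subsetDl _ _) _.
  by rewrite disjoint_sym.
have leU : #|BJ :\: I| + #|J :\: I| <= #|BJ|.
  apply: leq_trans (indep_card_basis (basis_indep mB) mBJ).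
  rewrite -cardsUI (_ : _ :&: _ = set0) ?cards0 ?addn0; last first.
    by apply/eqP; rewrite setI_eq0.
  by apply: subset_leq_card; rewrite subUset BJIB; apply/subsetP.
have leBI : #|BJ :&: I| <= #|I :\: J|.
  apply: subset_leq_card; apply/subsetP => x /setIP[xB xI].
  by rewrite inE xI andbT; apply/negP => xJ; rewrite (disjointFr dJ xJ) in xB.
have := cardsID I BJ; have := cardsID I J; have := cardsID J I.
rewrite (setIC J I) => e1 e2 e3; exfalso; move: leU leBI ltIJ.
rewrite -e3 -e1 -e2 addnC leq_add2r ltn_add2l => h1 h2 h3.
by have := leq_trans h3 (leq_trans h1 h2); rewrite ltnn.
Qed.

Definition dual_matroid : matroid T :=
  Matroid dual_indep_ground dual_indep0 dual_indep_sub dual_indep_aug.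

End Dual.

Definition isomorphic (T1 T2 : finType) (M : matroid T1) (N : matroid T2) :
    Prop :=
  exists f : T1 -> T2,
    [/\ {in ground M &, injective f},
        f @: ground M = ground N &
        forall X : {set T1}, X \subset ground M ->
          (f @: X \in indep N) = (X \in indep M)].

Definition self_dual (T : finType) (M : matroid T) : Prop :=
  isomorphic M (dual_matroid M).

Definition flat (T : finType) (M : matroid T) (F : {set T}) : bool :=
  (F \subset ground M) &&
  [forall x in ground M :\: F, rk M F < rk M (x |: F)].

Definition cyclic_flat (T : finType) (M : matroid T) (F : {set T}) : bool :=
  flat M F && [forall e, ~~ coloop (restriction M F) e].

Definition cyclic_flats (T : finType) (M : matroid T) : {set {set T}} :=
  [set F | cyclic_flat M F].

(* The lattice of cyclic flats is ordered by inclusion, so its isomorphisms are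
   the bijections preserving and reflecting inclusion. *)
Definition same_configuration (T1 T2 : finType)
    (M : matroid T1) (N : matroid T2) : Prop :=
  exists f : {set T1} -> {set T2},
    [/\ {in cyclic_flats M &, injective f},
        f @: cyclic_flats M = cyclic_flats N,
        {in cyclic_flats M &, forall F G : {set T1},
           (f F \subset f G) = (F \subset G)},
        {in cyclic_flats M, forall F, #|f F| = #|F|} &
        {in cyclic_flats M, forall F, rk N (f F) = rk M F}].

Definition connectivity (T : finType) (M : matroid T) (X : {set T}) : int :=
  ((rk M X)%:Z + (rk M (ground M :\: X))%:Z - (mrank M)%:Z)%R.

Definition separation (T : finType) (M : matroid T) (k : nat) (X : {set T}) :
    bool :=
  [&& X \subset ground M, k <= #|X|, k <= #|ground M :\: X| &
      (connectivity M X < k%:Z)%R].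

Definition has_separation (T : finType) (M : matroid T) (k : nat) : bool :=
  [exists X : {set T}, separation M k X].

(* In \bar int, x - +oo = -oo for every x, so a lower bound by a natural
   number on tau(N) - tau(M) forces tau(M) to be finite. *)
Definition tutte_connectivity (T : finType) (M : matroid T) : \bar int :=
  if pselect (exists k, has_separation M k) is left h
  then (((ex_minn h)%:Z)%:E)%E else (+oo)%E.

(* The matroid has no preferred ordering of its elements: e labels the columns
   by ground-set elements.  Maximal minors take columns in increasing order. *)
Definition positroid (R : realType) (T : finType) (M : matroid T) : Prop :=
  exists (A : 'M[R]_(mrank M, #|ground M|)) (e : 'I_#|ground M| -> T),
    [/\ injective e,
        e @: [set: 'I_#|ground M|] = ground M,
        forall J : {set 'I_#|ground M|},
          (e @: J \in indep M) =
          row_free (colsub (@enum_val _ (mem J)) A)^T%R &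
        forall g : 'I_(mrank M) -> 'I_#|ground M|,
          {homo g : i j / (i < j)%N} -> (0 <= \det (colsub g A))%R].

(* Union of matroids on a common ground set. *)
Definition matroid_union (T : finType) (k : nat) (Ms : 'I_k -> matroid T)
    (M : matroid T) : Prop :=
  (forall i, ground (Ms i) = ground M) /\
  forall X : {set T}, X \in indep M <->
    exists2 I : 'I_k -> {set T},
      forall i, I i \in indep (Ms i) & X = \bigcup_(i < k) I i.

Definition transversal_matroid (T : finType) (M : matroid T) : Prop :=
  exists (k : nat) (Ms : 'I_k -> matroid T),
    (forall i, mrank (Ms i) = 1%N) /\ matroid_union Ms M.

(* Main.v *)
Require Import Defs.
From mathcomp Require Import all_boot all_order all_fingroup all_algebra.
From mathcomp Require Import boolp constructive_ereal reals.
From mathcomp Require Import zify.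

(* Let [A] and [B] be subsets of size [3n] of a set of size [6n], with
   [#|A :&: B| = t <= n].  The sets [I] with [#|I| <= 3n], [#|I :&: A| <= 2n]
   and [#|I :&: B| <= 2n] are the independent sets of a matroid whose cyclic
   flats are the empty set, [A], [B] and the ground set, of ranks [0], [2n],
   [2n], [3n]; so the configuration does not depend on [t].  If [t = 0] then [B]
   is the complement of [A] and [A] is an [n.+1]-separation, while for [t = n]
   the rank formula leaves no [k]-separation with [k <= 2n].  A bijection
   exchanging [A] and [B] with their complements is an isomorphism with the
   dual.

   For a total order in which [B] is an initial segment and [A] a cyclic
   interval, the matroid is represented by a matrix whose first [t] columns
   (those of [A :&: B]) are signed unit vectors and whose other entries are
   [x ^+ (i * j)] on a staircase-shaped support.  For large [x] the diagonal
   term dominates the Leibniz expansion of every minor that it supports, so the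
   minors indexed by bases are positive.  A nonzero minor also contains a
   matching of its columns with the rows, which proves transversality. *)

Set Implicit Arguments.
Unset Strict Implicit.
Unset Printing Implicit Defensive.

Import Order.TTheory GRing.Theory Num.Theory.

(** * Rank, coloops and restrictions *)

Section MatroidRank.
Variables (T : finType) (M : matroid T).

Lemma indep_leq_rk (I X : {set T}) :
  I \in indep M -> I \subset X -> #|I| <= rk M X.
Proof. by move=> IM IX; apply: leq_bigmax_cond; rewrite IM. Qed.

Lemma rk_witness (X : {set T}) :
  exists2 I, I \in indep M & (I \subset X) && (#|I| == rk M X).
Proof.
have P0 : (set0 \in indep M) && (set0 \subset X) by rewrite indep0 sub0set.
have := @eq_bigmax_cond _ (fun I => (I \in indep M) && (I \subset X))
          (fun I => #|I|).
case=> [|I]; first by apply/card_gt0P; exists set0.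
rewrite unfold_in => /andP[IM IX] eI; exists I => //.
by rewrite IX /rk eI eqxx.
Qed.

Lemma coloopE (e : T) :
  coloop M e = (e \in ground M) && (rk M (ground M :\ e) < mrank M).
Proof.
rewrite /coloop; case eE: (e \in ground M) => //=.
apply/forall_inP/idP => [allB | lt_rk B mB].
  rewrite ltnNge; apply/negP => le_rk.
  have [I IM /andP[IX /eqP eI]] := rk_witness (ground M :\ e).
  have mI : basis M I.
    apply/maxsetP; split=> // J JM IJ; apply/eqP; rewrite eq_sym eqEcard IJ /=.
    by rewrite eI (leq_trans _ le_rk) // indep_leq_rk ?indep_ground.
  by have /(subsetP IX) := allB I mI; rewrite !inE eqxx.
apply/negPn/negP => eB.
have [I IM /andP[IX /eqP eI]] := rk_witness (ground M).
have := indep_card_basis IM mB; rewrite eI leqNgt.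
suff /leq_ltn_trans-> : #|B| <= rk M (ground M :\ e) by [].
rewrite indep_leq_rk ?basis_indep // subsetD1 eB andbT.
exact: indep_ground (basis_indep mB).
Qed.

Lemma rk_restriction (F X : {set T}) :
  rk (restriction M F) X = rk M (X :&: F).
Proof.
apply: eq_bigl => I; rewrite !inE subsetI.
by rewrite -andbA; congr (_ && _); rewrite andbC.
Qed.

End MatroidRank.

Lemma coloop_restriction (T : finType) (M : matroid T) (F : {set T})
    (e : T) : F \subset ground M ->
  coloop (restriction M F) e = (e \in F) && (rk M (F :\ e) < rk M F).
Proof.
move=> /setIidPr FE; rewrite coloopE /mrank !rk_restriction /restrict_ground.
rewrite /= /restrict_ground FE setIid; congr (_ && (rk M _ < _)).
by apply/setP=> x; rewrite !inE -andbA andbb.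
Qed.

(** * The matroid determined by the flats [A] and [B] *)

Section TwoFlats.
Variables (T : finType) (n : nat) (A B : {set T}).
Hypothesis leAB : #|A :&: B| <= n.

Definition tf_indep : {set {set T}} :=
  [set I : {set T} |
    [&& #|I| <= 3 * n, #|I :&: A| <= 2 * n & #|I :&: B| <= 2 * n]].

(** Each term bounds an independent subset of [X]. A term combining [A] and [B] would be at least
    [2n + 2n - n], so never below [3n], because [#|A :&: B| <= n]. *)
Definition tf_rk (X : {set T}) : nat :=
  minn (minn #|X| (3 * n)) (minn (2 * n + #|X :\: A|) (2 * n + #|X :\: B|)).

Lemma tf_indep_sub (I J : {set T}) :
  J \in tf_indep -> I \subset J -> I \in tf_indep.
Proof.
rewrite !inE => /and3P[h1 h2 h3] IJ; apply/and3P; split.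
- exact: leq_trans (subset_leq_card IJ) h1.
- exact: leq_trans (subset_leq_card (setSI _ IJ)) h2.
- exact: leq_trans (subset_leq_card (setSI _ IJ)) h3.
Qed.

Lemma tf_indep_leq_rk (I X : {set T}) :
  I \in tf_indep -> I \subset X -> #|I| <= tf_rk X.
Proof.
rewrite inE => /and3P[h1 h2 h3] IX.
have := subset_leq_card IX.
have := subset_leq_card (setSD A IX); have := subset_leq_card (setSD B IX).
have := cardsID A I; have := cardsID B I; rewrite /tf_rk; lia.
Qed.

(** If [#|I| < 3n], every element of [X] outside [I] lies in a flat whose bound [I] attains. If only
    [A] is tight, [I] contains [X :\: A] and has [2n + #|X :\: A|] elements; if both are,
    [#|I| >= 3n]; if neither is, [X] lies in [I]. Augmentation and the rank formula both follow. *)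
Lemma tf_rk_leq_maximal (I X : {set T}) : I \in tf_indep -> I \subset X ->
  (forall x, x \in X :\: I -> x |: I \notin tf_indep) -> tf_rk X <= #|I|.
Proof.
rewrite inE => /and3P[h1 h2 h3] IX Imax.
have [eI|neI] := eqVneq #|I| (3 * n); first by rewrite /tf_rk; lia.
have UI (x : T) (C : {set T}) : x \notin I ->
    #|(x |: I) :&: C| = (x \in C) + #|I :&: C|.
  move=> xI; have [xC|xC] := boolP (x \in C).
    rewrite (_ : _ :&: C = x |: (I :&: C)); last first.
      by apply/setP=> y; rewrite !inE; case: eqP => //= ->.
    by rewrite cardsU1 inE (negPf xI).
  rewrite (_ : _ :&: C = I :&: C) //; apply/setP=> y; rewrite !inE.
  by case: eqP => //= ->; rewrite (negPf xI) (negPf xC).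
have tight x : x \in X -> x \notin I ->
    (x \in A) && (#|I :&: A| == 2 * n) || (x \in B) && (#|I :&: B| == 2 * n).
  move=> xX xI; have := Imax x; rewrite !inE xX xI !UI // cardsU1 xI /=.
  move=> /(_ isT); case: (x \in A); case: (x \in B); lia.
have tight1 (C D : {set T}) : #|I :&: D| != 2 * n ->
    (forall x, x \in X -> x \notin I ->
    (x \in C) && (#|I :&: C| == 2 * n) || (x \in D) && (#|I :&: D| == 2 * n)) ->
    #|I :&: C| = 2 * n -> 2 * n + #|X :\: C| <= #|I|.
  move=> /negPf nD tCD eC; rewrite -(cardsID C I) eC leq_add2l.
  apply/subset_leq_card/subsetP=> x; rewrite !inE => /andP[xC xX].
  rewrite xC /=; apply/negPn/negP => xI.
  by have := tCD _ xX xI; rewrite nD (negPf xC) andbF.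
have [eA|nA] := eqVneq #|I :&: A| (2 * n).
  have [eB|nB] := eqVneq #|I :&: B| (2 * n).
    have : #|(I :&: A) :&: (I :&: B)| <= n.
      apply: leq_trans leAB; apply/subset_leq_card/subsetP=> x.
      by rewrite !inE => /andP[/andP[_ ->] /andP[_ ->]].
    have := cardsUI (I :&: A) (I :&: B).
    have : #|I :&: A :|: I :&: B| <= #|I|.
      by apply: subset_leq_card; rewrite -setIUr subsetIl.
    rewrite /tf_rk; lia.
  by have := tight1 A B nB tight eA; rewrite /tf_rk; lia.
have [eB|nB] := eqVneq #|I :&: B| (2 * n).
  have tightC x (xX : x \in X) (xI : x \notin I) :
    (x \in B) && (#|I :&: B| == 2 * n) || (x \in A) && (#|I :&: A| == 2 * n).
    by rewrite orbC tight.
  by have := tight1 B A nA tightC eB; rewrite /tf_rk; lia.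
have /subset_leq_card : X \subset I.
  apply/subsetP=> x xX; apply/negPn/negP => xI.
  by have := tight x xX xI; rewrite (negPf nA) (negPf nB) !andbF.
rewrite /tf_rk; lia.
Qed.

Lemma tf_indep_ground (I : {set T}) : I \in tf_indep -> I \subset [set: T].
Proof. by rewrite subsetT. Qed.

Lemma tf_indep0 : set0 \in tf_indep.
Proof. by rewrite inE !set0I !cards0. Qed.

(** Without an augmenting element [I] would be maximal in [I :|: J], so at least as large as
    [tf_rk (I :|: J)], which bounds [#|J|]. *)
Lemma tf_indep_aug (I J : {set T}) :
  I \in tf_indep -> J \in tf_indep -> #|I| < #|J| ->
  exists2 x, x \in J :\: I & x |: I \in tf_indep.
Proof.
move=> II IJ ltIJ; apply/exists_inP; apply: contraLR ltIJ => noaug.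
rewrite -leqNgt; apply: leq_trans (tf_indep_leq_rk IJ (subsetUr I J)) _.
apply: tf_rk_leq_maximal (subsetUl I J) _ => // x.
rewrite setDUl setDv set0U => xJ; apply: contra noaug => xI.
by apply/exists_inP; exists x.
Qed.

Definition two_flats : matroid T :=
  Matroid tf_indep_ground tf_indep0 tf_indep_sub tf_indep_aug.

Lemma rk_two_flats (X : {set T}) : rk two_flats X = tf_rk X.
Proof.
apply/eqP; rewrite eqn_leq; apply/andP; split.
  by have [I IM /andP[IX /eqP<-]] := rk_witness two_flats X;
    apply: tf_indep_leq_rk.
pose P (I : {set T}) := (I \in tf_indep) && (I \subset X).
have P0 : P set0 by rewrite /P tf_indep0 sub0set.
have [I /maxsetP[/andP[II IX] Imax] _] := maxset_exists P0.
apply: leq_trans (indep_leq_rk (II : I \in indep two_flats) IX).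
apply: tf_rk_leq_maximal => // x /setDP[xX xI]; apply/negP => xII.
have := Imax (x |: I); rewrite /P xII subUset sub1set xX IX => /(_ isT).
by move=> /(_ (subsetUr _ _)) /setP/(_ x); rewrite setU11 (negPf xI).
Qed.

Hypotheses (n_gt0 : 0 < n) (cardT : #|T| = 6 * n).
Hypotheses (cardA : #|A| = 3 * n) (cardB : #|B| = 3 * n).

Let cardAB : #|A :\: B| = 3 * n - #|A :&: B|.
Proof. by rewrite cardsD cardA. Qed.
Let cardBA : #|B :\: A| = 3 * n - #|A :&: B|.
Proof. by rewrite cardsD cardB setIC. Qed.

Let cardCA : #|~: A| = 3 * n.
Proof. by have := cardsC A; rewrite cardA cardT; lia. Qed.
Let cardCB : #|~: B| = 3 * n.
Proof. by have := cardsC B; rewrite cardB cardT; lia. Qed.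

Lemma mrank_two_flats : mrank two_flats = 3 * n.
Proof.
by rewrite /mrank rk_two_flats /tf_rk !setTD cardsT cardT cardCA cardCB; lia.
Qed.

Lemma basis_two_flats (C : {set T}) :
  basis two_flats C = (C \in tf_indep) && (#|C| == 3 * n).
Proof.
apply/maxsetP/andP => [[CI Cmax]|[CI /eqP eC]]; split=> //.
  rewrite eqn_leq; apply/andP; split.
    by move: CI; rewrite inE; case/and3P.
  rewrite -mrank_two_flats /mrank rk_two_flats.
  apply: tf_rk_leq_maximal (subsetT _) _ => // x /setDP[_ xC].
  apply/negP => xI; have := Cmax _ xI (subsetUr _ _).
  by move/setP/(_ x); rewrite setU11 (negPf xC).
move=> D DI CD; apply/eqP; rewrite eq_sym eqEcard CD eC.
by move: DI; rewrite /= inE => /and3P[].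
Qed.

Lemma tf_indep_extend (I : {set T}) : I \in tf_indep ->
  exists2 C : {set T}, (C \in tf_indep) && (#|C| == 3 * n) & I \subset C.
Proof.
move=> II.
have [C mC IC] := @maxset_exists _ (fun I => I \in indep two_flats) _ II.
by exists C; rewrite // -basis_two_flats.
Qed.

Lemma two_flats_coloopless e : ~~ coloop two_flats e.
Proof.
rewrite coloopE mrank_two_flats rk_two_flats /= inE -leqNgt /tf_rk.
have := cardsD1 e [set: T]; rewrite inE cardsT cardT.
have h (C : {set T}) : #|~: C| <= #|[set: T] :\ e :\: C| + 1.
  rewrite setDDl setUC -setDDl setTD (cardsD1 e (~: C)); lia.
by have := h A; have := h B; rewrite cardCA cardCB; lia.
Qed.

(** The term attaining the rank determines [F]. If it is [#|F|], any element of [F] would be a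
    coloop; if it is [3n], no further element raises the rank; if it is the term of [A], elements of
    [F] outside [A] would be coloops and elements of [A] outside [F] would not raise the rank. *)
Lemma cyclic_flat_two_flats F : cyclic_flat two_flats F =
  [|| F == set0, F == A, F == B | F == [set: T]].
Proof.
have coloopF e : coloop (restriction two_flats F) e =
    (e \in F) && (tf_rk (F :\ e) < tf_rk F).
  by rewrite coloop_restriction ?subsetT // !rk_two_flats.
have flatF : flat two_flats F = [forall x in ~: F, tf_rk F < tf_rk (x |: F)].
  rewrite /flat subsetT /=; apply: eq_forallb => x.
  by rewrite setTD !rk_two_flats.
rewrite /cyclic_flat flatF.
have D1 (x : T) (C : {set T}) : #|C| <= #|C :\ x| + 1.
  by rewrite (cardsD1 x C); lia.
have DD1 (x : T) (C D : {set T}) : #|C :\: D| <= #|C :\ x :\: D| + 1.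
  by rewrite setDDl setUC -setDDl; apply: D1.
apply/andP/idP => [[/forall_inP flF /forallP cyF]|].
  have {}flF x : x \notin F -> tf_rk F < tf_rk (x |: F).
    by move=> xF; apply: flF; rewrite inE.
  have {}cyF x : x \in F -> tf_rk F <= tf_rk (F :\ x).
    by move=> xF; have := cyF x; rewrite coloopF xF /= -leqNgt.
  have [e1|n1] := eqVneq (tf_rk F) #|F|.
    have [->|[x xF]] := set_0Vmem F; first by rewrite eqxx.
    have := cyF x xF; rewrite e1 /tf_rk; have := cardsD1 x F; rewrite xF; lia.
  have [e2|n2] := eqVneq (tf_rk F) (3 * n).
    have -> : F = [set: T]; last by rewrite eqxx !orbT.
    apply/setP=> x; rewrite inE; apply/idPn => /flF.
    by rewrite e2 /tf_rk; lia.
  have one C : (forall X, tf_rk X <= 2 * n + #|X :\: C|) ->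
      tf_rk F = 2 * n + #|F :\: C| -> F = C.
    move=> leC eF; have FC : F \subset C.
      apply/subsetP=> x xF; apply/negPn/negP => xC.
      have := cyF x xF; have := leC (F :\ x); rewrite setDDl setUC -setDDl.
      by have := cardsD1 x (F :\: C); rewrite inE xF xC eF; lia.
    apply/eqP; rewrite eqEsubset FC; apply/subsetP=> x xC.
    apply/negPn/negP => xF; have := flF x xF; have := leC (x |: F).
    by rewrite eF setDUl (eqP (_ : [set x] :\: C == set0)) ?set0U ?setD_eq0
      ?sub1set //; lia.
  have [e3|n3] := eqVneq (tf_rk F) (2 * n + #|F :\: A|).
    rewrite (one A) ?eqxx ?orbT // => X; rewrite /tf_rk; lia.
  have [e4|n4] := eqVneq (tf_rk F) (2 * n + #|F :\: B|).
    rewrite (one B) ?eqxx ?orbT // => X; rewrite /tf_rk; lia.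
  by move: n1 n2 n3 n4; rewrite /tf_rk; lia.
have newD (D : {set T}) x : x \notin D -> 0 < #|(x |: D) :\: D|.
  by move=> xD; apply/card_gt0P; exists x; rewrite !inE eqxx xD.
case/or4P=> /eqP eF; split; try (apply/forall_inP => x; rewrite inE);
  try (apply/forallP => x; rewrite coloopF); rewrite eF ?inE //.
(* What remains is flatness of [set0], both properties of [A] and of [B], and the absence of coloops
   in the ground set. *)
- by rewrite /tf_rk setU0 cards0 cards1; lia.
- move=> xA; have := newD _ _ xA.
  have := subset_leq_card (setSD B (subsetUr [set x] A)).
  by rewrite /tf_rk setDv cards0 cardsU1 xA cardA cardAB; lia.
- have [xA|//] := boolP (x \in A); rewrite /= -leqNgt.
  by have := DD1 x A B; have := D1 x A;
    rewrite /tf_rk setDv cards0 cardA cardAB; lia.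
- move=> xA; have := newD _ _ xA.
  have := subset_leq_card (setSD A (subsetUr [set x] B)).
  by rewrite /tf_rk setDv cards0 cardsU1 xA cardB cardBA; lia.
- have [xA|//] := boolP (x \in B); rewrite /= -leqNgt.
  by have := DD1 x B A; have := D1 x B;
    rewrite /tf_rk setDv cards0 cardB cardBA; lia.
- rewrite /= -leqNgt; have := two_flats_coloopless x.
  by rewrite coloopE /mrank !rk_two_flats /= inE -leqNgt.
Qed.

(** The proof compares the terms attaining the ranks of [X] and [~: X]. The hypothesis
    [#|A :&: B| = n] enters for the pair [2n + #|X :\: A|] and [2n + #|~: X :\: B|]: together they
    count the [n] elements outside [A :|: B], so the connectivity is at least [5n - 3n >= k]. *)
Lemma two_flats_no_separation k : #|A :&: B| = n -> k <= 2 * n ->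
  ~~ has_separation two_flats k.
Proof.
move=> eAB lek; apply/negP => /existsP[X].
rewrite /separation /connectivity mrank_two_flats !rk_two_flats /= setTD.
rewrite subsetT /= => /and3P[].
have split (C : {set T}) : #|X :\: C| + #|~: X :\: C| = #|~: C|.
  by rewrite -(cardsID X (~: C)) !setDE (setIC X) (setIC (~: X)).
have mix : n <= #|X :\: A| + #|~: X :\: B| /\ n <= #|X :\: B| + #|~: X :\: A|.
  have : #|~: (A :|: B)| = n.
    by have := cardsC (A :|: B); have := cardsUI A B;
      rewrite eAB cardA cardB cardT; lia.
  have mixCD (C D : {set T}) :
      #|~: (C :|: D)| <= #|X :\: C| + #|~: X :\: D|.
    rewrite -(cardsID X); apply: leq_add; apply/subset_leq_card/subsetP=> x;
      by rewrite !inE negb_or; case: (x \in C); case: (x \in D);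
        case: (x \in X).
  by move=> <-; split; [|rewrite setUC]; apply: mixCD.
have leD (Y C : {set T}) : #|Y :\: C| <= #|Y|.
  by apply/subset_leq_card/subsetDl.
move: (leD X A) (leD X B) (leD (~: X) A) (leD (~: X) B).
have := cardsC X; rewrite cardT; move: mix (split A) (split B).
by rewrite cardCA cardCB /tf_rk; lia.
Qed.

(** Both sides have rank [2n], so the connectivity of [A] is [n]. *)
Lemma two_flats_separation : ~: A = B -> has_separation two_flats n.+1.
Proof.
move=> eAB; apply/existsP; exists A.
rewrite /separation /connectivity mrank_two_flats !rk_two_flats /= setTD eAB.
rewrite subsetT /tf_rk !setDv cards0 cardA cardB cardAB cardBA; lia.
Qed.

End TwoFlats.

(** * Configurations and the gap in connectivity *)

Lemma four_sets_subset (T : finType) (n : nat) (A B : {set T}) : 0 < n ->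
  #|T| = 6 * n -> #|A| = 3 * n -> #|B| = 3 * n -> #|A :&: B| <= n ->
  [/\ (A \subset set0) = false, (B \subset set0) = false,
      ([set: T] \subset set0) = false, ([set: T] \subset A) = false &
      [/\ ([set: T] \subset B) = false, (A \subset B) = false &
      (B \subset A) = false]].
Proof.
move=> n0 cT cA cB cAB; split; [..|split]; apply/negP;
  try by move/subset_leq_card; rewrite ?cards0 ?cardsT; lia.
- by move/setIidPl => eAB; move: cAB; rewrite eAB; lia.
- by move/setIidPr => eAB; move: cAB; rewrite eAB; lia.
Qed.

Lemma rk_two_flats_cyclic (T : finType) (n : nat) (A B : {set T})
    (leAB : #|A :&: B| <= n) : 0 < n ->
  #|T| = 6 * n -> #|A| = 3 * n -> #|B| = 3 * n ->
  [/\ rk (two_flats leAB) set0 = 0, rk (two_flats leAB) A = 2 * n,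
      rk (two_flats leAB) B = 2 * n & rk (two_flats leAB) [set: T] = 3 * n].
Proof.
move=> n0 cT cA cB; split; last exact: mrank_two_flats;
  rewrite rk_two_flats /tf_rk ?set0D ?setDv ?cards0 ?cardsD ?cA ?cB.
- lia.
- lia.
- rewrite (setIC B); lia.
Qed.

(** Both lattices are Boolean with the two given flats as atoms, and the sizes and ranks depend on
    [n] only. *)
Lemma two_flats_same_configuration (n : nat) (T T' : finType)
    (A B : {set T}) (A' B' : {set T'})
    (leAB : #|A :&: B| <= n) (leAB' : #|A' :&: B'| <= n) : 0 < n ->
  #|T| = 6 * n -> #|A| = 3 * n -> #|B| = 3 * n ->
  #|T'| = 6 * n -> #|A'| = 3 * n -> #|B'| = 3 * n ->
  same_configuration (two_flats leAB) (two_flats leAB').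
Proof.
move=> n0 cT cA cB cT' cA' cB'.
have [a1 a2 a3 a4 [a5 a6 a7]] := four_sets_subset n0 cT cA cB leAB.
have [b1 b2 b3 b4 [b5 b6 b7]] := four_sets_subset n0 cT' cA' cB' leAB'.
pose f (F : {set T}) : {set T'} :=
  if F == set0 then set0 else if F == A then A' else
  if F == B then B' else [set: T'].
have f0 : f set0 = set0 by rewrite /f eqxx.
have fA : f A = A' by rewrite /f eqEsubset a1 /= eqxx.
have fB : f B = B'.
  by rewrite /f eqEsubset a2 /= eqEsubset a7 /= eqxx.
have fT : f [set: T] = [set: T'].
  by rewrite /f eqEsubset a3 /= eqEsubset a4 /= eqEsubset a5.
have cyc F : F \in cyclic_flats (two_flats leAB) ->
    [\/ F = set0, F = A, F = B | F = [set: T]].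
  rewrite inE cyclic_flat_two_flats //.
  by case/or4P => /eqP;
    [constructor 1|constructor 2|constructor 3|constructor 4].
have cyc' F : F \in cyclic_flats (two_flats leAB') ->
    [\/ F = set0, F = A', F = B' | F = [set: T']].
  rewrite inE cyclic_flat_two_flats //.
  by case/or4P => /eqP;
    [constructor 1|constructor 2|constructor 3|constructor 4].
have f_sub : {in cyclic_flats (two_flats leAB) &,
    forall F G : {set T}, (f F \subset f G) = (F \subset G)}.
  by move=> F G /cyc[]-> /cyc[]->; rewrite ?f0 ?fA ?fB ?fT ?sub0set ?subsetT
    ?subxx ?a1 ?a2 ?a3 ?a4 ?a5 ?a6 ?a7 ?b1 ?b2 ?b3 ?b4 ?b5 ?b6 ?b7.
exists f; split=> //.
- move=> F G cF cG eFG; apply/eqP.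
  by rewrite eqEsubset -!f_sub // eFG subxx.
- apply/setP=> G; apply/imsetP/idP => [[F /cyc[]-> ->]|/cyc'[]->];
    rewrite ?f0 ?fA ?fB ?fT ?inE ?cyclic_flat_two_flats ?eqxx ?orbT //.
  + by exists set0; rewrite ?f0 ?inE ?cyclic_flat_two_flats ?eqxx.
  + by exists A; rewrite ?fA ?inE ?cyclic_flat_two_flats ?eqxx ?orbT.
  + by exists B; rewrite ?fB ?inE ?cyclic_flat_two_flats ?eqxx ?orbT.
  + by exists [set: T]; rewrite ?fT ?inE ?cyclic_flat_two_flats ?eqxx ?orbT.
- by move=> F /cyc[]->;
    rewrite ?f0 ?fA ?fB ?fT ?cards0 ?cardsT ?cA ?cB ?cA' ?cB' ?cT ?cT'.
- have [r1 r2 r3 r4] := rk_two_flats_cyclic leAB n0 cT cA cB.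
  have [s1 s2 s3 s4] := rk_two_flats_cyclic leAB' n0 cT' cA' cB'.
  by move=> F /cyc[]->;
    rewrite ?f0 ?fA ?fB ?fT ?r1 ?r2 ?r3 ?r4 ?s1 ?s2 ?s3 ?s4.
Qed.

Lemma tutte_connectivity_gap (T1 T2 : finType) (M : matroid T1)
    (N : matroid T2) (n : nat) : has_separation M n.+1 ->
  (forall k, k <= 2 * n -> ~~ has_separation N k) ->
  (n%:Z%:E <= tutte_connectivity N - tutte_connectivity M)%E.
Proof.
move=> sM sN; rewrite /tutte_connectivity.
case: (pselect (exists k, has_separation M k)) => [hM|[]]; last by exists n.+1.
case: (ex_minnP hM) => m _ /(_ _ sM) lem.
(* If [N] has no separation, its connectivity [+oo] minus the finite value [m] is still [+oo]. *)
case: pselect => [hN|_]; last by rewrite leey.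
case: (ex_minnP hN) => k sk _.
have ltk : 2 * n < k by rewrite ltnNge; apply: contraL sk; apply: sN.
by rewrite -EFinB lee_fin; lia.
Qed.

(** * Increasing sequences and the rearrangement inequality *)

Section IncreasingOrdinals.
Variables (m : nat) (f : 'I_m -> nat).
Hypothesis f_incr : {homo f : i j / i < j}.

Lemma incr_ord_add (i j : 'I_m) : i <= j -> f i + (j - i) <= f j.
Proof.
case: j => j; elim: j => [|j IHj] jm; rewrite /= => ij.
  by rewrite (_ : Ordinal jm = i) ?addn0 //; apply: val_inj => /=; lia.
have [eij|nij] := eqVneq (i : nat) j.+1.
  by rewrite (_ : Ordinal jm = i) ?eij ?subnn ?addn0 //; apply: val_inj.
have := @f_incr (Ordinal (ltnW jm)) (Ordinal jm) (ltnSn j).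
by have /= := IHj (ltnW jm); lia.
Qed.

Lemma incr_ord_ge (i : 'I_m) : i <= f i.
Proof.
have := @incr_ord_add (Ordinal (leq_ltn_trans (leq0n i) (ltn_ord i))) i.
by rewrite /=; lia.
Qed.

Lemma incr_ord_le K : (forall i, f i < K) -> forall i, f i + (m - i) <= K.
Proof.
move=> fK i; have lm : m.-1 < m by have := ltn_ord i; lia.
have := @incr_ord_add i (Ordinal lm); have := fK (Ordinal lm).
by have := ltn_ord i; rewrite /=; lia.
Qed.

Lemma incr_ord_inj : injective f.
Proof.
move=> i j eij; apply: val_inj; case: (ltngtP i j) => // /f_incr; lia.
Qed.

End IncreasingOrdinals.

Lemma card_ord_lt (N k : nat) : k <= N -> #|[set j : 'I_N | j < k]| = k.
Proof.
move=> kN; rewrite -[RHS](card_ord k) -cardsT.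
have inj_w : injective (widen_ord kN) by move=> i j [/val_inj].
rewrite -(card_imset _ inj_w).
apply: eq_card => j; rewrite inE; apply/idP/imsetP => [jk|[i _ ->]] /=.
  by exists (Ordinal jk) => //; apply: val_inj.
exact: ltn_ord.
Qed.

Lemma card_ordS (m : nat) (p : pred 'I_m.+1) :
  #|[set j | p j]| = p ord0 + #|[set j | p (lift ord0 j)]|.
Proof.
have cardE k (q : pred 'I_k) : #|[set j | q j]| = \sum_(j < k) q j.
  by rewrite -sum1dep_card big_mkcond; apply: eq_bigr => j _; case: (q j).
by rewrite !cardE big_ord_recl.
Qed.

(** Without inversions [s] is increasing, so [i <= s i] and [s i + (m - i) <= m], which leaves only
    the identity. *)
Lemma perm_inversion (m : nat) (s : 'S_m) :
  s != 1%g -> exists i j : 'I_m, i < j /\ s j < s i.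
Proof.
move=> s1; apply/not_existsP => noinv; move/negP: s1; apply.
have s_incr : {homo (fun i => s i : nat) : i j / i < j}.
  move=> i j ij; rewrite ltnNge; apply/negP => le_s; apply: (noinv i).
  exists j; split=> //; rewrite ltn_neqAle le_s andbT; apply/eqP.
  by move/val_inj/perm_inj => eij; rewrite eij ltnn in ij.
apply/eqP/permP=> i; rewrite perm1; apply: val_inj.
have := incr_ord_ge s_incr i.
have := incr_ord_le s_incr (fun i => ltn_ord (s i)) i.
by have := ltn_ord i; rewrite /=; lia.
Qed.

(** Swapping the values at an inversion [i < j] of [u] adds [(r j - r i) * (c (u i) - c (u j)) > 0],
    so a permutation of largest weight is the identity. One improvement of [s] itself makes the
    inequality strict. *)
Lemma rearrangement_lt (m : nat) (r c : 'I_m -> nat) (s : 'S_m) :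
  {homo r : i j / i < j} -> {homo c : i j / i < j} -> s != 1%g ->
  \sum_i r i * c (s i) < \sum_i r i * c i.
Proof.
move=> r_incr c_incr s1; pose W (u : 'S_m) := \sum_i r i * c (u i).
have improve u : u != 1%g -> exists v, W u < W v.
  case/perm_inversion=> i [j [ij uji]]; exists (tperm i j * u)%g.
  have nij : j != i by apply: contraTneq ij => ->; rewrite ltnn.
  have W2 v : W v = r i * c (v i) + (r j * c (v j) +
      \sum_(k | (k != i) && (k != j)) r k * c (v k)).
    by rewrite /W (bigD1 i) //= (bigD1 j).
  rewrite !W2 !permM tpermL tpermR.
  rewrite [in ltnRHS](eq_bigr (fun k => r k * c (u k)));
    last by move=> k /andP[ki kj]; rewrite permM tpermD // eq_sym.
  have := r_incr _ _ ij; have := c_incr _ _ uji.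
  by rewrite !addnA ltn_add2r; nia.
case: (@arg_maxnP _ 1%g xpredT W isT) => v _ vmax.
have v1 : v = 1%g.
  apply/eqP/negPn/negP => /improve[w]; rewrite ltnNge => /negP; apply.
  exact: vmax.
have [w ltw] := improve s s1.
have -> : \sum_i r i * c i = W v.
  by rewrite v1; apply: eq_bigr => i _; rewrite perm1.
exact: leq_trans ltw (vmax w isT).
Qed.

(** * Positive minors of the representing matrix *)

Section Determinants.
Local Open Scope ring_scope.

(* Each term of the Leibniz expansion other than the diagonal one is smaller
   than it by a factor [x], by the rearrangement inequality. *)
Lemma det_diag_dominant_gt0 (R : realDomainType) (m x : nat)
    (r c : 'I_m -> nat) (b : 'I_m -> 'I_m -> bool) :
  {homo r : i j / (i < j)%N} -> {homo c : i j / (i < j)%N} ->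
  (forall i, b i i) -> (m`! <= x)%N ->
  0 < \det (\matrix_(i, j) if b i j then x%:R ^+ (r i * c j) else 0 : R).
Proof.
move=> r_incr c_incr bii le_x; rewrite /determinant (bigD1 1%g) //=.
have x0 : (0 < x)%N := leq_trans (fact_gt0 m) le_x.
set W := (\sum_i r i * c i)%N.
rewrite odd_perm1 expr0 mul1r (eq_bigr (fun i => x%:R ^+ (r i * c i)));
  last first.
  by move=> i _; rewrite perm1 !mxE bii.
rewrite prodrXr -/W; set rest := \sum_(s | _) _.
have term (s : 'S_m) : s != 1%g ->
    x%:R * `|(-1) ^+ s * \prod_i (\matrix_(i, j)
       if b i j then x%:R ^+ (r i * c j) else 0 : R) i (s i)| <= x%:R ^+ W.
  move=> s1; rewrite normrM normrX normrN1 expr1n mul1r normr_prod.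
  apply: (@le_trans _ _ (x%:R * \prod_i x%:R ^+ (r i * c (s i)))).
    rewrite ler_wpM2l ?ler0n //; apply: ler_prod => i _; rewrite normr_ge0 mxE.
    case: (b i (s i)); last by rewrite normr0 exprn_ge0.
    by rewrite ger0_norm ?lexx // exprn_ge0.
  rewrite prodrXr -exprS; apply: ler_weXn2l; first by rewrite ler1n.
  exact: rearrangement_lt.
(* The sum has [m! - 1] terms, fewer than [x]. *)
have le_rest : x%:R * `|rest| <= (m`!.-1)%:R * x%:R ^+ W.
  apply: (@le_trans _ _ (\sum_(s : 'S_m | s != 1%g) x%:R ^+ W)).
    rewrite (le_trans (ler_wpM2l _ (ler_norm_sum _ _ _))) ?ler0n //.
    by rewrite mulr_sumr; apply: ler_sum => s; apply: term.
  rewrite sumr_const [leRHS]mulr_natl (_ : #|_| = m`!.-1) //.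
  by rewrite -card_Sn -(cardC1 (1%g : 'S_m)); apply: eq_card.
have lt_rest : `|rest| < x%:R ^+ W.
  rewrite -(ltr_pM2l (_ : 0 < x%:R :> R)) ?ltr0n //.
  apply: le_lt_trans le_rest _; rewrite ltr_pM2r ?exprn_gt0 ?ltr0n //.
  by rewrite ltr_nat; have := fact_gt0 m; lia.
move: lt_rest; rewrite ltr_norml => /andP[lt_rest _].
by rewrite -ltrBlDl sub0r.
Qed.

(* Columns [j < t] represent [A :&: B]; then come [B :\: A] up to [3 * n], the
   complement of [A :|: B] up to [3 * n + t], and [A :\: B].  Rows [i < n]
   vanish on [A] and rows [i >= 2 * n] vanish on [B].  Any base at least the number of
   terms of a Leibniz expansion would do in place of [(3 * n)`!]. *)
Definition pmx_supp (n t i j : nat) : bool :=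
  ((i < n) ==> (j < 3 * n + t))%N && ((2 * n <= i) ==> (3 * n <= j))%N.

Definition pmx (R : pzRingType) (n t i j : nat) : R :=
  if (j < t)%N then if (i + j.+1 == 2 * n)%N then (-1) ^+ i else 0
  else if pmx_supp n t i j then (3 * n)`!%:R ^+ (i * j) else 0.

Section Minors.
Variables (R : realDomainType) (n t : nat).
Hypothesis le_tn : (t <= n)%N.

(** The two counts keep the diagonal inside the support. If [r i < n] but [c i >= 3n + t], the
    [m - i] columns from [i] on are all that large, so [i >= n], against [i <= r i]. If [r i >= 2n]
    but [c i < 3n], the first [i + 1] columns are all that small, so [m - i > n], against
    [r i + (m - i) <= 3n]. *)
Lemma pmx_minor_gt0_no_unit (m : nat) (r c : 'I_m -> nat) :
  {homo r : i j / (i < j)%N} -> {homo c : i j / (i < j)%N} ->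
  (forall i, r i < 3 * n)%N -> (forall j, t <= c j)%N ->
  (#|[set j | 3 * n + t <= c j]| + n <= m)%N ->
  (#|[set j | c j < 3 * n]| + n <= m)%N ->
  0 < \det (\matrix_(i, j) pmx R n t (r i) (c j)).
Proof.
move=> r_incr c_incr r_lt c_ge leA leB.
have le_m : (m <= 3 * n)%N.
  case: m r c r_incr c_incr r_lt c_ge leA leB => // m r c r_incr _ r_lt _ _ _.
  by have := incr_ord_le r_incr r_lt ord0; rewrite subn0; lia.
have supp i : pmx_supp n t (r i) (c i).
  have im := ltn_ord i.
  apply/andP; split; apply/implyP => ri; rewrite leqNgt; apply/negP => ci.
    have := incr_ord_ge r_incr i.
    suff : (m - i <= #|[set j | 3 * n + t <= c j]|)%N by lia.
    have -> : (m - i = #|~: [set j : 'I_m | j < i]|)%N.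
      by rewrite -{1}(card_ord m) -(cardsC [set j : 'I_m | j < i]%N)
        card_ord_lt ?(ltnW im) // addKn.
    apply/subset_leq_card/subsetP=> j; rewrite !inE -leqNgt => ij.
    by have := incr_ord_add c_incr ij; lia.
  have := incr_ord_le r_incr r_lt i.
  suff : (i.+1 <= #|[set j | c j < 3 * n]|)%N by lia.
  rewrite -(card_ord_lt im); apply/subset_leq_card/subsetP=> j; rewrite !inE.
  by rewrite ltnS => ij; have := incr_ord_add c_incr ij; lia.
have := @det_diag_dominant_gt0 R m _ r c (fun i j => pmx_supp n t (r i) (c j))
  r_incr c_incr supp (leq_fact le_m).
rewrite (_ : (\matrix_(i, j) pmx R n t (r i) (c j)) = 
  (\matrix_(i, j) if pmx_supp n t (r i) (c j)
    then (3 * n)`!%:R ^+ (r i * c j) else 0)) //.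
by apply/matrixP=> i j; rewrite !mxE /pmx ltnNge c_ge.
Qed.

(* The columns below [t] are signed unit vectors.  Expanding along the first of
   them deletes the lowest row still involved, so the rows of the remaining
   ones keep their positions and the signs cancel. *)
Lemma pmx_minor_gt0 (m : nat) (r c : 'I_m -> nat) :
  {homo r : i j / (i < j)%N} -> {homo c : i j / (i < j)%N} ->
  (forall i, r i < 3 * n)%N ->
  (forall j k, (c j < t)%N -> (k + c j < 2 * n)%N ->
     exists2 i : 'I_m, i = k :> nat & r i = k) ->
  (#|[set j | 3 * n + t <= c j]| + #|[set j | c j < t]| + n <= m)%N ->
  (#|[set j | c j < 3 * n]| + n <= m)%N ->
  0 < \det (\matrix_(i, j) pmx R n t (r i) (c j)).
Proof.
elim: m r c => [|m IHm] r c r_incr c_incr r_lt rows leA leB.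
  by rewrite det_mx00.
have [c0|c0] := ltnP (c ord0) t; last first.
  apply: pmx_minor_gt0_no_unit => //; last by lia.
  move=> j; apply: leq_trans c0 _.
  by have := @incr_ord_add _ _ c_incr ord0 j (leq0n _); lia.
have [i0 ei0 ri0] : exists2 i : 'I_m.+1,
    i = (2 * n - (c ord0).+1)%N :> nat & r i = (2 * n - (c ord0).+1)%N.
  by apply: (rows ord0) => //; lia.
rewrite (expand_det_col _ ord0) (bigD1 i0) //= big1 => [|i ii0]; last first.
  rewrite mxE /pmx c0; case: eqP => [e|]; last by rewrite mul0r.
  by case/eqP: ii0; apply: (incr_ord_inj r_incr); lia.
have e0 : pmx R n t (r i0) (c ord0) = (-1) ^+ i0.
  by rewrite /pmx c0 ri0 -ei0 (_ : (i0 + _)%N = (2 * n)%N) ?eqxx; last lia.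
rewrite addr0 [X in X * _]mxE e0 /cofactor addn0 mulrA -exprD addnn.
rewrite -signr_odd odd_double mul1r.
have lift_incr (h : 'I_m.+1) : {homo lift h : i j / (i < j)%N}.
  by move=> i j; rewrite /= /bump; lia.
rewrite (_ : row' _ _ = \matrix_(i, j)
    pmx R n t (r (lift i0 i)) (c (lift ord0 j))); last first.
  by apply/matrixP=> i j; rewrite !mxE.
apply: IHm.
- by move=> i j ij; apply/r_incr/lift_incr.
- by move=> i j ij; apply/c_incr/lift_incr.
- by move=> i; apply: r_lt.
(* [c ord0 < c (lift ord0 j)] forces [k < i0], so row [k] lies above the deleted row. *)
- move=> j k cj kj; have [i ei ri] := rows _ _ cj kj.
  have := c_incr ord0 (lift ord0 j) isT => c0j.
  have i0m := ltn_ord i0; have km : (k < m)%N by lia.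
  exists (Ordinal km) => //; rewrite -[RHS]ri; congr r; apply: val_inj.
  by rewrite /= /bump; lia.
- by move: leA; rewrite !card_ordS /= c0; lia.
- by move: leB; rewrite card_ordS /=; lia.
Qed.

End Minors.

End Determinants.

(** * Self-duality *)

Lemma two_flats_self_dual (T : finType) (n : nat) (A B : {set T})
    (leAB : #|A :&: B| <= n) (f : T -> T) : 0 < n ->
  #|T| = 6 * n -> #|A| = 3 * n -> #|B| = 3 * n -> involutive f ->
  (forall x, (f x \in A) = (x \notin A)) ->
  (forall x, (f x \in B) = (x \notin B)) -> self_dual (two_flats leAB).
Proof.
move=> n0 cT cA cB fK fA fB; have f_inj := inv_inj fK.
have basisE := basis_two_flats leAB n0 cT cA cB.
(* For either flat [D], [f] exchanges [D] with its complement, so [~: f @: C] meets [D] in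
   [3n - #|C :\: D| = #|C :&: D|] elements. *)
have compl (C : {set T}) : basis (two_flats leAB) C ->
    basis (two_flats leAB) (~: f @: C).
  rewrite !basisE => /andP[]; rewrite inE => /and3P[_ C2 C3] /eqP eC.
  have meet (D : {set T}) : #|D| = 3 * n ->
      (forall x, (f x \in D) = (x \notin D)) ->
      #|~: f @: C :&: D| = #|C :&: D|.
    move=> cD fD; have : #|f @: C :&: D| = #|C :\: D|.
      rewrite -(card_imset (C :\: D) f_inj); apply: eq_card => x; rewrite inE.
      apply/andP/imsetP => [[/imsetP[y yC ->]]|[y]].
        by rewrite fD => yD; exists y; rewrite // inE yD.
      by rewrite inE => /andP[yD yC] ->; rewrite imset_f // fD.
    have := cardsID (f @: C) D; have := cardsID D C.
    by rewrite [~: _ :&: D]setIC -setDE (setIC D) cD eC; lia.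
  have := cardsC (f @: C); rewrite card_imset // cT => cC.
  by rewrite inE (meet A) // (meet B) // C2 C3; lia.
exists f; split=> [x y _ _ /f_inj//| |X _].
  by apply/setP=> x; rewrite inE -[x]fK imset_f ?inE.
rewrite inE; apply/exists_inP/idP => [[D mD XD]|XI].
  have := compl D mD; rewrite basisE => /andP[/tf_indep_sub DI _].
  apply: DI; apply/subsetP=> x xX; rewrite inE; apply/imsetP => -[y yD ex].
  have /(subsetP XD) : f x \in f @: X by apply: imset_f.
  by rewrite !inE ex fK yD.
have [C CI XC] := tf_indep_extend leAB n0 cT cA cB XI.
exists (~: f @: C); first by apply: compl; rewrite basisE.
by rewrite setTD setCK imsetS.
Qed.

(** * Matroids of rank one *)

Section RankOne.
Variables (T : finType) (S : {set T}).

(** [S] is the set of non-loops; in a union of such matroids the independent sets are the partial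
    transversals of the sets [S]. *)
Definition rank1_indep : {set {set T}} :=
  [set I : {set T} | (#|I| <= 1) && (I \subset S)].

Fact rank1_indep_ground I : I \in rank1_indep -> I \subset [set: T].
Proof. by rewrite subsetT. Qed.

Fact rank1_indep0 : set0 \in rank1_indep.
Proof. by rewrite inE cards0 sub0set. Qed.

Fact rank1_indep_sub (I J : {set T}) :
  J \in rank1_indep -> I \subset J -> I \in rank1_indep.
Proof.
rewrite !inE => /andP[J1 JS] IJ; rewrite (subset_trans IJ JS) andbT.
exact: leq_trans (subset_leq_card IJ) J1.
Qed.

Fact rank1_indep_aug (I J : {set T}) :
  I \in rank1_indep -> J \in rank1_indep -> #|I| < #|J| ->
  exists2 x, x \in J :\: I & x |: I \in rank1_indep.
Proof.
rewrite !inE => _ /andP[J1 JS] IJ.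
have : #|I| == 0 by lia.
rewrite cards_eq0 => /eqP I0; rewrite I0 in IJ *.
have /card_gt0P[x xJ] : 0 < #|J| by lia.
exists x; first by rewrite setD0.
by rewrite setU0 inE cards1 sub1set (subsetP JS).
Qed.

Definition rank1_matroid : matroid T :=
  Matroid rank1_indep_ground rank1_indep0 rank1_indep_sub rank1_indep_aug.

Lemma mrank_rank1 : 0 < #|S| -> mrank rank1_matroid = 1.
Proof.
case/card_gt0P=> x xS; apply/eqP; rewrite /mrank eqn_leq; apply/andP; split.
  have [I + /andP[_ /eqP<-]] := rk_witness rank1_matroid (ground rank1_matroid).
  by rewrite inE => /andP[].
rewrite -(cards1 x); apply: indep_leq_rk; rewrite ?subsetT //.
by rewrite inE cards1 sub1set.
Qed.

End RankOne.

Lemma leq_card_bigcup (I : finType) (T : finType) (F : I -> {set T}) :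
  #|\bigcup_i F i| <= \sum_i #|F i|.
Proof.
elim/big_rec2: _ => [|i U k _ le]; first by rewrite cards0.
by apply: leq_trans (leq_card_setU _ _) _; rewrite leq_add2l.
Qed.

(** Turns a basis into an increasing choice of columns, as maximal minors require. *)
Lemma incr_enum (K m : nat) (J : {set 'I_K}) : #|J| = m ->
  exists2 g : 'I_m -> 'I_K, {homo g : i j / i < j} & g @: [set: 'I_m] = J.
Proof.
move=> <-; exists enum_val.
  have srt : sorted (fun x y : 'I_K => x < y) (enum J).
    apply: sorted_filter; first by move=> x y z; apply: ltn_trans.
    by rewrite -enumT; have := iota_ltn_sorted 0 K;
      rewrite -val_enum_ord sorted_map.
  move=> i j ij; rewrite (enum_val_nth (enum_val i)).
  rewrite [in ltnRHS](enum_val_nth (enum_val i)).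
  apply: (sorted_ltn_nth _ _ srt) => //; rewrite ?inE -?cardE //.
  by move=> x y z; apply: ltn_trans.
apply/setP=> x; apply/imsetP/idP => [[i _ ->]|xJ]; first exact: enum_valP.
by exists (enum_rank_in xJ x); rewrite ?inE ?enum_rankK_in.
Qed.

(** * Ranks and determinants over a field *)

Section MatrixFacts.
Variable F : fieldType.
Local Open Scope ring_scope.

Lemma row_free_rowsub (k m n : nat) (f : 'I_k -> 'I_m) (N : 'M[F]_(m, n)) :
  injective f -> row_free N -> row_free (rowsub f N).
Proof.
move=> f_inj /row_freeP[N' NN']; apply/row_freeP.
exists (N' *m (rowsub f 1%:M)^T); rewrite mulmxA mul_rowsub_mx NN'.
apply/matrixP=> i j; rewrite !mxE (bigD1 (f i)) //= big1 => [|l li].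
  by rewrite !mxE eqxx mul1r addr0 (inj_eq f_inj) eq_sym.
by rewrite !mxE eq_sym (negPf li) mul0r.
Qed.

Lemma mxrank_leq_support (m n : nat) (N : 'M[F]_(m, n)) (L : {set 'I_n}) :
  (forall i j, j \notin L -> N i j = 0) -> (\rank N <= #|L|)%N.
Proof.
move=> N0.
have -> : N = colsub (@enum_val _ (mem L)) N *m
              rowsub (@enum_val _ (mem L)) 1%:M.
  apply/matrixP=> i j; rewrite !mxE.
  under eq_bigr do rewrite !mxE.
  rewrite -(big_enum_val (A := mem L) (fun l => N i l * (l == j)%:R)) /=.
  have [jL|jL] := boolP (j \in L); last first.
    rewrite big1 ?N0 // => l lL; case: eqP => [e|]; last by rewrite mulr0.
    by rewrite -e lL in jL.
  rewrite (bigD1 j) //= eqxx mulr1 big1 ?addr0 // => l /andP[_ /negPf->].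
  by rewrite mulr0.
exact: mulmx_max_rank.
Qed.

(** Some Leibniz term is nonzero; its permutation matches each row with a column where that row does
    not vanish. *)
Lemma det_neq0_perm (m : nat) (N : 'M[F]_m) : \det N != 0 ->
  exists s : 'S_m, forall i, N i (s i) != 0.
Proof.
move=> dN; apply: contrapT => noS; case/eqP: dN; apply: big1 => s _.
apply/eqP; rewrite mulf_eq0; apply/orP; right; apply/negPn/negP.
by move=> /prodf_neq0 sN; apply: noS; exists s => i; apply: sN.
Qed.

End MatrixFacts.

(** * The matroids on a cycle of [6n] points *)

Section AntipodalMatroid.
Variables (n t : nat).
Hypotheses (n_gt0 : 0 < n) (le_tn : t <= n).

Definition flatA : {set 'I_(6 * n)} :=
  [set j : 'I_(6 * n) | (j < t) || (3 * n + t <= j)].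
Definition flatB : {set 'I_(6 * n)} := [set j : 'I_(6 * n) | j < 3 * n].

Lemma card_flatB : #|flatB| = 3 * n.
Proof. by rewrite card_ord_lt // leq_mul2r orbT. Qed.

Lemma card_flatA : #|flatA| = 3 * n.
Proof.
pose L k := [set j : 'I_(6 * n) | j < k].
have -> : flatA = L t :|: ~: L (3 * n + t).
  by apply/setP=> j; rewrite !inE -leqNgt.
have LL : L t :&: ~: L (3 * n + t) = set0.
  by apply/setP=> j; rewrite !inE; lia.
have := cardsC (L (3 * n + t)); have := cardsUI (L t) (~: L (3 * n + t)).
rewrite LL cards0 card_ord (@card_ord_lt _ t); last by lia.
rewrite (@card_ord_lt _ (3 * n + t)); last by lia.
by move: #|L t :|: _| #|~: _| => a b; lia.
Qed.

Lemma card_flatAB : #|flatA :&: flatB| = t.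
Proof.
rewrite -[RHS](@card_ord_lt (6 * n)); last by lia.
by apply: eq_card => j; rewrite !inE; lia.
Qed.

Lemma leq_flatAB : #|flatA :&: flatB| <= n.
Proof. by rewrite card_flatAB. Qed.

Definition antipodal_matroid : matroid 'I_(6 * n) := two_flats leq_flatAB.

(** The half-turn of the cycle. Both flats are arcs of [3n] points, so it exchanges each with its
    complement. *)
Definition antipode_val (j : nat) := if j < 3 * n then j + 3 * n else j - 3 * n.

Fact antipode_subproof (j : 'I_(6 * n)) : antipode_val j < 6 * n.
Proof.
by have := ltn_ord j; rewrite /antipode_val; case: (ltnP j (3 * n)); lia.
Qed.

Definition antipode (j : 'I_(6 * n)) := Ordinal (antipode_subproof j).

Lemma antipodal_self_dual : self_dual antipodal_matroid.
Proof.
apply: (two_flats_self_dual _ (f := antipode)) => //.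
- by rewrite card_ord.
- exact: card_flatA.
- exact: card_flatB.
- move=> j; apply: val_inj; have := ltn_ord j.
  by rewrite /= /antipode_val; case: (ltnP j (3 * n)) => ? ?; case: ifP; lia.
- by move=> j; have := ltn_ord j; rewrite !inE /= /antipode_val;
    case: (ltnP j (3 * n)); lia.
- by move=> j; have := ltn_ord j; rewrite !inE /= /antipode_val;
    case: (ltnP j (3 * n)); lia.
Qed.

Lemma mrank_antipodal : mrank antipodal_matroid = 3 * n.
Proof.
by apply: mrank_two_flats; rewrite ?card_ord ?card_flatA ?card_flatB.
Qed.

(** For a column [j < t] the nonzero entry is in row [2n - 1 - j], which is at least [n] because
    [t <= n]. *)
Lemma pmx_flatA (R : pzRingType) (i : nat) (j : 'I_(6 * n)) :
  i < n -> j \in flatA -> pmx R n t i j = 0%R.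
Proof.
rewrite inE /pmx /pmx_supp => lt_in; case: ltnP => [jt _|jt /= le_j].
  by case: eqP => //; lia.
by rewrite lt_in (ltnNge j) le_j.
Qed.

Lemma pmx_flatB (R : pzRingType) (i : nat) (j : 'I_(6 * n)) :
  2 * n <= i -> j \in flatB -> pmx R n t i j = 0%R.
Proof.
rewrite inE /pmx /pmx_supp => le_ni lt_j; case: ltnP => jt.
  by case: eqP => //; lia.
by rewrite le_ni (leqNgt _ j) lt_j andbF.
Qed.

(** All [3n] rows are used, so the bounds [2n = m - n] on [A] and [B] become the counting hypotheses
    of [pmx_minor_gt0]. *)
Lemma pmx_basis_gt0 (R : realDomainType) (m : nat) (c : 'I_m -> 'I_(6 * n)) :
  m = 3 * n -> {homo c : i j / i < j} ->
  c @: [set: 'I_m] \in tf_indep n flatA flatB ->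
  (0 < \det (\matrix_(i, j) pmx R n t i (c j)))%R.
Proof.
move=> em c_incr; rewrite inE => /and3P[_ cA cB].
have c_inj : injective c.
  by move=> i j eij; apply: (incr_ord_inj (f := c) c_incr); rewrite eij.
have meet (D : {set 'I_(6 * n)}) :
    #|c @: [set: 'I_m] :&: D| = #|[set j | c j \in D]|.
  rewrite -(card_imset _ c_inj); apply: eq_card => x; rewrite inE.
  apply/andP/imsetP => [[/imsetP[j _ ->] cD]|[j]].
    by exists j; rewrite ?inE.
  by rewrite inE => cD ->; rewrite imset_f ?inE.
apply: (@pmx_minor_gt0 R n t le_tn m (fun i => i) (fun j => c j)) => //.
- by move=> i; rewrite -em.
- move=> j k _ lt_k; have km : k < m by lia.
  by exists (Ordinal km).
- move: cA; rewrite meet.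
  have <- : [set j | 3 * n + t <= c j] :|: [set j | c j < t] =
            [set j | c j \in flatA].
    by apply/setP=> j; rewrite !inE orbC.
  have := cardsUI [set j | 3 * n + t <= c j] [set j | c j < t].
  rewrite (_ : _ :&: _ = set0) ?cards0; first by lia.
  by apply/setP=> j; rewrite !inE; lia.
- move: cB; rewrite meet.
  have <- : [set j | c j < 3 * n] = [set j | c j \in flatB].
    by apply/setP=> j; rewrite !inE.
  by lia.
Qed.

(** [S i] contains the support of row [i], so a nonzero minor on a basis gives a transversal.
    Conversely, at most [2n] of the sets meet [A] and at most [2n] meet [B]. *)
Lemma antipodal_transversal : transversal_matroid antipodal_matroid.
Proof.
pose S (i : 'I_(3 * n)) : {set 'I_(6 * n)} :=
  if i < n then ~: flatA else if i < 2 * n then setT else ~: flatB.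
exists (3 * n), (fun i => rank1_matroid (S i)); split=> [i|].
  apply: mrank_rank1; rewrite /S; have := cardsC flatA; have := cardsC flatB.
  rewrite card_flatA card_flatB card_ord.
  by case: ifP => _; [|case: ifP => _; rewrite ?cardsT ?card_ord]; lia.
split=> // X; split=> [XI|[I II ->]].
  have [|||C /andP[CI /eqP cC] XC] := tf_indep_extend leq_flatAB n_gt0 _ _ _ XI.
  - by rewrite card_ord.
  - exact: card_flatA.
  - exact: card_flatB.
  have [g g_incr gC] := incr_enum cC.
  have := @pmx_basis_gt0 rat _ g erefl g_incr; rewrite gC => /(_ CI).
  move/lt0r_neq0/det_neq0_perm => [s sN].
  exists (fun i => X :&: [set g (s i)]) => [i|].
    rewrite inE; apply/andP; split.
      by rewrite -[leqRHS](cards1 (g (s i))) subset_leq_card ?subsetIr.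
    apply/subsetP=> x /setIP[_ /set1P->]; have := sN i; rewrite mxE /S => ne0.
    case: ltnP => [lt_in|_].
      by rewrite inE; apply: contraNN ne0 => gA; rewrite pmx_flatA.
    case: ltnP => [_|le_ni]; first by rewrite inE.
    by rewrite inE; apply: contraNN ne0 => gB; rewrite pmx_flatB.
  apply/setP=> x; apply/idP/bigcupP => [xX|[i _ /setIP[]//]].
  have /imsetP[j _ ex] : x \in g @: [set: 'I_(3 * n)].
    by rewrite gC (subsetP XC).
  by exists (s^-1%g j); rewrite // !inE xX permKV ex eqxx.
have I1 i : #|I i| <= 1 by have := II i; rewrite inE => /andP[].
have IS i : I i \subset S i by have := II i; rewrite inE => /andP[].
have bound (D : {set 'I_(6 * n)}) (p : pred 'I_(3 * n)) :
    (forall i, ~~ p i -> S i \subset ~: D) ->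
    #|\bigcup_i I i :&: D| <= #|[set i | p i]|.
  move=> pD; have -> : \bigcup_i I i :&: D = \bigcup_i (I i :&: D).
    by rewrite big_distrl.
  apply: leq_trans (leq_card_bigcup _) _.
  rewrite -sum1dep_card [leqRHS]big_mkcond; apply: leq_sum => i _.
  case: ifPn => [_|/pD SD].
    by apply: leq_trans (I1 i); rewrite subset_leq_card ?subsetIl.
  rewrite leqn0 cards_eq0 setI_eq0 disjoints_subset.
  exact: subset_trans (IS i) SD.
rewrite inE; apply/and3P; split.
- apply: leq_trans (leq_card_bigcup _) _.
  apply: (@leq_trans (\sum_(i < 3 * n) 1)); first exact: leq_sum.
  by rewrite sum1_card card_ord.
- apply: leq_trans (bound _ (fun i => ~~ (i < n)) _) _ => [i|].
    by rewrite negbK /S => ->.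
  have -> : [set i : 'I_(3 * n) | ~~ (i < n)] = ~: [set i : 'I_(3 * n) | i < n].
    by apply/setP=> i; rewrite !inE.
  have := cardsC [set i : 'I_(3 * n) | i < n].
  by rewrite card_ord card_ord_lt; lia.
- apply: leq_trans (bound _ (fun i => i < 2 * n) _) _ => [i|].
    by rewrite /S -leqNgt => le_i;
      rewrite !ltnNge le_i (leq_trans _ le_i) //; lia.
  by rewrite card_ord_lt; lia.
Qed.

Local Open Scope ring_scope.

(** An independent set extends to a basis, whose minor is positive, so its columns are free.
    Conversely, columns in [A] vanish on the first [n] rows and those in [B] on the last [n], so
    free columns include at most [2n] from each. A nonzero maximal minor thus belongs to a basis and
    is positive. *)
Lemma antipodal_positroid (R : realType) : positroid R antipodal_matroid.
Proof.
have eK : #|ground antipodal_matroid| = (6 * n)%N by rewrite cardsT card_ord.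
have em := mrank_antipodal.
set m := mrank antipodal_matroid in em *; pose K := #|ground antipodal_matroid|.
pose N : 'M[R]_(m, K) := \matrix_(i, j) pmx R n t i j.
pose e : 'I_K -> 'I_(6 * n) := cast_ord eK.
have e_inj : injective e := @cast_ord_inj _ _ eK.
have e_surj x : exists j, e j = x.
  by exists (cast_ord (esym eK) x); rewrite /e cast_ordKV.
have minor_gt0 (g : 'I_m -> 'I_K) : {homo g : i j / (i < j)%N} ->
    e @: (g @: [set: 'I_m]) \in indep antipodal_matroid ->
    0 < \det (colsub g N).
  move=> g_incr gI.
  rewrite (_ : colsub g N = \matrix_(i, j) pmx R n t i (e (g j))).
    by apply: (@pmx_basis_gt0 R m (fun j => e (g j)) em) => //;
      rewrite imset_comp.
  by apply/matrixP=> i j; rewrite !mxE.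
have sub_free (g : 'I_m -> 'I_K) (J : {set 'I_K}) : \det (colsub g N) != 0 ->
    J \subset g @: [set: 'I_m] ->
    row_free (colsub (@enum_val _ (mem J)) N)^T.
  move=> dg Jg.
  have /all_sig[h hP] (k : 'I_#|J|) : {i | g i = enum_val k}.
    apply: cid; have /(subsetP Jg)/imsetP[i _ ->] := enum_valP k.
    by exists i.
  have -> : (colsub (@enum_val _ (mem J)) N)^T = rowsub h (colsub g N)^T.
    by apply/matrixP=> i j; rewrite !mxE hP.
  apply: row_free_rowsub.
    by move=> k l ekl; apply: enum_val_inj; rewrite -!hP ekl.
  by rewrite row_free_unit unitmx_tr unitmxE unitfE.
have free_bound (J : {set 'I_K}) (D : {set 'I_(6 * n)}) (L : {set 'I_m}) :
    row_free (colsub (@enum_val _ (mem J)) N)^T ->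
    (forall i j, i \notin L -> e j \in D -> N i j = 0) ->
    (#|e @: J :&: D| <= #|L|)%N.
  move=> Jfree ND; pose H := [set k : 'I_#|J| | e (enum_val k) \in D].
  have -> : #|e @: J :&: D| = #|H|.
    have inj_eH : injective (fun k : 'I_#|J| => e (enum_val k)).
      by move=> k l /e_inj/enum_val_inj.
    rewrite -(card_imset _ inj_eH); apply: eq_card => x; rewrite inE.
    apply/andP/imsetP => [[/imsetP[j jJ ->] jD]|[k]].
      exists (enum_rank_in jJ j); last by rewrite enum_rankK_in.
      by rewrite inE enum_rankK_in.
    by rewrite inE => kD ->; rewrite imset_f ?enum_valP.
  (* The chosen columns lying in [D] are free and supported on the rows in [L]. *)
  have := row_free_rowsub (@enum_val_inj _ (mem H)) Jfree.
  rewrite /row_free => /eqP<-; apply: mxrank_leq_support => k i iL.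
  rewrite !mxE; have := enum_valP k; rewrite inE => kD.
  by have := ND i _ iL kD; rewrite mxE.
have free_indep (J : {set 'I_K}) :
    row_free (colsub (@enum_val _ (mem J)) N)^T ->
    e @: J \in indep antipodal_matroid.
  move=> Jfree; rewrite inE; apply/and3P; split.
  - rewrite -(setIT (e @: J)).
    apply: leq_trans (free_bound J _ [set: 'I_m] Jfree _) _.
      by move=> i j; rewrite inE.
    by rewrite cardsT card_ord em.
  - apply: leq_trans (free_bound J _ (~: [set i : 'I_m | i < n]%N) Jfree _) _.
      move=> i j + eA; rewrite !inE negbK mxE => lt_i.
      exact: (pmx_flatA R lt_i eA).
    have := cardsC [set i : 'I_m | i < n]%N.
    rewrite card_ord card_ord_lt; last by rewrite em; lia.
    by move: #|~: _| => a; rewrite em; lia.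
  - apply: leq_trans (free_bound J _ [set i : 'I_m | i < 2 * n]%N Jfree _) _.
      move=> i j + eB; rewrite inE -leqNgt mxE => le_i.
      exact: (pmx_flatB R le_i eB).
    by rewrite card_ord_lt // em; lia.
exists N, e; split=> //.
- by apply/setP=> x; rewrite inE; have [j <-] := e_surj x; rewrite imset_f ?inE.
- move=> J; apply/idP/idP => [JI|]; last exact: free_indep.
  have [|||C /andP[CI /eqP cC] JC] := tf_indep_extend leq_flatAB n_gt0 _ _ _ JI.
  + by rewrite card_ord.
  + exact: card_flatA.
  + exact: card_flatB.
  have eC : e @: (e @^-1: C) = C.
    apply/setP=> x; apply/imsetP/idP => [[j]|xC].
      by rewrite inE => jC ->.
    by have [j ex] := e_surj x; exists j; rewrite ?inE ex.
  have cC' : #|e @^-1: C| = m by rewrite -(card_imset _ e_inj) eC cC.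
  have [g g_incr gC] := incr_enum cC'.
  apply: (sub_free g); first by rewrite gt_eqF // minor_gt0 // gC eC.
  rewrite gC; apply/subsetP=> j jJ; rewrite inE (subsetP JC) //.
  exact: imset_f.
- move=> g g_incr; have [->//|dg] := eqVneq (\det (colsub g N)) 0.
  by apply/ltW/minor_gt0/free_indep/(sub_free g).
Qed.

End AntipodalMatroid.

Theorem theorem4p2 (R : realType) (n : nat) (n_gt0 : (0 < n)%N) :
  exists (T1 T2 : finType) (M' : matroid T1) (N' : matroid T2),
    ((forall e, ~~ coloop M' e) /\ (forall e, ~~ coloop N' e)) /\
    (self_dual M' /\ self_dual N') /\
    (positroid R M' /\ positroid R N') /\
    (transversal_matroid M' /\ transversal_matroid N') /\
    same_configuration M' N' /\
    (n%:Z%:E <= tutte_connectivity N' - tutte_connectivity M')%E.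
Proof.
have cT : #|'I_(6 * n)| = (6 * n)%N by rewrite card_ord.
have cB := card_flatB n.
have cA0 := card_flatA n_gt0 (leq0n n); have cAn := card_flatA n_gt0 (leqnn n).
(* [M'] takes [t = 0], where the flats are complementary, and [N'] takes [t = n]. *)
exists 'I_(6 * n), 'I_(6 * n), (antipodal_matroid n_gt0 (leq0n n)),
  (antipodal_matroid n_gt0 (leqnn n)).
split; first by split=> e; exact: two_flats_coloopless.
split; first by split; apply: antipodal_self_dual.
split; first by split; apply: antipodal_positroid.
split; first by split; apply: antipodal_transversal.
split; first exact: two_flats_same_configuration.
apply: tutte_connectivity_gap.
  apply: two_flats_separation => //.
  by apply/setP=> j; rewrite !inE addn0 -ltnNge.
by move=> k le_k; apply: two_flats_no_separation => //; apply: card_flatAB.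
Qed.
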